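(* Let $V=\{v_1,\dots,v_n\}$ be a finite set and let $w_\ell, w_h : V\times V\to\mathbb{R}$ be two symmetric weight functions. Let $\alpha_{\mathrm{OPT}}$ be the minimal $\alpha$ such that there exists an ultrametric $\Delta^*$ on $V$ with $w_\ell(v_i,v_j)\le \Delta^*(v_i,v_j)\le \alpha\, w_h(v_i,v_j)$ for all $v_i,v_j\in V$. Let $\gamma\ge 1$ and $\delta\ge 1$. Consider the following procedure: (1) compute a $\gamma$-approximate Kruskal tree $T$ of the complete graph $G_h$ on $V$ with edge weights $w_h$; (2) compute a $\delta$-estimate $ACW$ of the cut weights of all edges of $T$; (3) construct the cartesian tree $T_C$ of $T$ with respect to the edge values $ACW$; (4) output the ultrametric $\Delta$ induced by $T_C$ on $V$. Then the output $\Delta$ is an ultrametric satisfying, for all $v_i,v_j\in V$, $$w_\ell(v_i,v_j)\le \Delta(v_i,v_j)\le \gamma\cdot\delta\cdot\alpha_{\mathrm{OPT}}\cdot w_h(v_i,v_j).$$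
   Context: An ultrametric on $V$ is a metric $\Delta$ with $\Delta(x,y)\le\max(\Delta(x,z),\Delta(z,y))$ for all $x,y,z$. For a spanning tree $T$ of the complete graph on $V$ and an edge $e=(x,y)\notin T$, let $C^T_e$ be the cycle consisting of $e$ together with the unique path from $x$ to $y$ in $T$. A spanning tree $T$ is a $\gamma$-approximate Kruskal tree ($\gamma$-KT) for weights $w_h$ if for every edge $e\notin T$, $w_h(e)\ge \frac{1}{\gamma}\max_{e'\in C^T_e} w_h(e')$. For an edge $e$ of $T$, removing $e$ splits $T$ into two components with vertex sets $L(e)$ and $R(e)$; $P(e)$ is the set of pairs $(v_i,v_j)$ with $v_i\in L(e)$, $v_j\in R(e)$ such that $e$ is an edge of maximum $w_h$-weight on the path from $v_i$ to $v_j$ in $T$ (i.e. the maximum weight of an edge on that path is $w_h(e)$). The cut weight of $e$ is $CW(e)=\max_{(v_i,v_j)\in P(e)} w_\ell(v_i,v_j)$. A function $ACW$ on the edges of $T$ is a $\delta$-estimate of the cut weights if $CW(e)\le ACW(e)\le \delta\cdot CW(e)$ for every edge $e$ of $T$. The cartesian tree $T_C$ of $T$ with respect to $ACW$ is the rooted tree whose root corresponds to the edge $e$ of $T$ with maximal $ACW$ value, and whose two children are recursively the cartesian trees of the two components $L(e)$, $R(e)$ of $T\setminus e$; its leaves are the vertices of $V$, leaves have height $0$, and the internal node corresponding to edge $e$ has height $ACW(e)$. The induced ultrametric is $\Delta(v_i,v_j)=$ height of the least common ancestor of $v_i,v_j$ in $T_C$ (equivalently, the $ACW$ value of the first edge,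 in decreasing order of $ACW$, that separates $v_i$ from $v_j$ in $T$).
   Formalization: That Δ is an ultrametric is claimed only when ACW > 0 on all edges of T (a pseudo-ultrametric when ACW ≥ 0), since zero or negative cut weights can give Δ(x,y) ≤ 0 for distinct x, y; the two-sided bounds are stated for all real weights. *)

(* Defs.v *)
From HB Require Import structures.
From mathcomp Require Import all_boot all_order all_algebra.
Set Implicit Arguments.
Unset Strict Implicit.
Unset Printing Implicit Defensive.
Import Order.TTheory GRing.Theory Num.Theory.
Local Open Scope ring_scope.

Definition is_pseudometric (V : Type) (R : numDomainType) (D : V -> V -> R) :=
  [/\ forall x y, 0 <= D x y,
      forall x, D x x = 0,
      forall x y, D x y = D y x &
      forall x y z, D x y <= D x z + D z y].

Definition is_metric (V : Type) (R : numDomainType) (D : V -> V -> R) :=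
  is_pseudometric D /\ forall x y, D x y = 0 -> x = y.

Definition strong_triangle (V : Type) (R : realDomainType) (D : V -> V -> R) :=
  forall x y z, D x y <= Num.max (D x z) (D z y).

Definition is_ultrametric (V : Type) (R : realDomainType) (D : V -> V -> R) :=
  is_metric D /\ strong_triangle D.

(* What remains of the ultrametric axioms when some cut weights, hence some
   heights of internal nodes of the cartesian tree, are zero. *)
Definition is_pseudo_ultrametric (V : Type) (R : realDomainType)
    (D : V -> V -> R) :=
  is_pseudometric D /\ strong_triangle D.

Definition feasible (V : Type) (R : realDomainType) (wl wh : V -> V -> R)
    (alpha : R) :=
  exists D : V -> V -> R, is_ultrametric D /\
    forall x y, wl x y <= D x y <= alpha * wh x y.

Definition is_alpha_opt (V : Type) (R : realDomainType) (wl wh : V -> V -> R)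
    (alpha : R) :=
  feasible wl wh alpha /\ forall beta, feasible wl wh beta -> alpha <= beta.

(* A graph on V is an adjacency relation; an undirected edge {a, b} is handled
   through either of its orientations.  A sequence of size 2 is a [ucycle] of
   any symmetric relation having that edge, hence the bound on genuine cycles. *)
Definition is_spanning_tree (V : finType) (T : rel V) :=
  [/\ symmetric T, irreflexive T, forall x y, connect T x y &
      forall c : seq V, ucycle T c -> (size c <= 2)%N].

(* The simple path from x to y in T, without its starting vertex x (the
   convention of [path]).  A simple path has fewer than #|V| edges, so the
   choice ranges over a finite type; it is unique when T is a tree. *)
Definition tree_path (V : finType) (T : rel V) (x y : V) : seq V :=
  if [pick p : {bseq #|V| of V} |
       [&& path T x p, last x p == y & uniq (x :: p)]] is Some p
  then bseqval p else [::].

Definition path_edges (V : finType) (T : rel V) (x y : V) : seq (V * V) :=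
  let p := tree_path T x y in zip (x :: p) p.

(* The cycle C^T_(x,y) contains the edge (x, y) itself, which serves as the
   default value of the iterated maximum. *)
Definition cycle_max (V : finType) (R : realDomainType) (T : rel V)
    (w : V -> V -> R) (x y : V) : R :=
  \big[Num.max/w x y]_(f <- path_edges T x y) w f.1 f.2.

Definition is_approx_kruskal_tree (V : finType) (R : realFieldType) (gamma : R)
    (w : V -> V -> R) (T : rel V) :=
  is_spanning_tree T /\
  forall x y, x != y -> ~~ T x y -> gamma^-1 * cycle_max T w x y <= w x y.

Definition del_edge (V : finType) (T : rel V) (a b : V) : rel V :=
  [rel x y | [&& T x y, (x, y) != (a, b) & (x, y) != (b, a)]].

(* For an edge e = (a, b), [side T a b] and [side T b a] are L(e) and R(e). *)
Definition side (V : finType) (T : rel V) (a b : V) : {set V} :=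
  [set z | connect (del_edge T a b) a z].

(* P(e): the path from L(e) to R(e) crosses e = (a, b) in the direction a, b. *)
Definition cut_pairs (V : finType) (R : realDomainType) (T : rel V)
    (wh : V -> V -> R) (a b : V) : {set V * V} :=
  [set u | [&& u.1 \in side T a b, u.2 \in side T b a,
               (a, b) \in path_edges T u.1 u.2 &
               all (fun f => wh f.1 f.2 <= wh a b)
                   (path_edges T u.1 u.2)]].

(* The default value is harmless: (a, b) is in P(e) when e = (a, b) is an edge
   of the tree T. *)
Definition cut_weight (V : finType) (R : realDomainType) (T : rel V)
    (wl wh : V -> V -> R) (a b : V) : R :=
  \big[Num.max/wl a b]_(u in cut_pairs T wh a b) wl u.1 u.2.

(* ACW is a function of undirected edges; its values off T are irrelevant. *)
Definition is_cut_weight_estimate (V : finType) (R : realDomainType) (delta : R)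
    (T : rel V) (wl wh ACW : V -> V -> R) :=
  (forall a b, T a b -> ACW a b = ACW b a) /\
  (forall a b, T a b ->
     cut_weight T wl wh a b <= ACW a b <= delta * cut_weight T wl wh a b).

Inductive ctree (V : Type) : Type :=
| Leaf of V
| Node of V & V & ctree V & ctree V.

Definition induced (V : finType) (T : rel V) (S : {set V}) : rel V :=
  [rel x y | [&& x \in S, y \in S & T x y]].

(* [cartesian T ACW S t]: t is a cartesian tree of the subtree of T spanned by
   S.  Ties between edges of maximal ACW value may be broken arbitrarily. *)
Inductive cartesian (V : finType) (R : realDomainType) (T : rel V)
    (ACW : V -> V -> R) : {set V} -> ctree V -> Prop :=
| CartLeaf (v : V) : cartesian T ACW [set v] (Leaf v)
| CartNode (S : {set V}) (a b : V) (l r : ctree V) :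
    induced T S a b ->
    (forall x y, induced T S x y -> ACW x y <= ACW a b) ->
    cartesian T ACW (side (induced T S) a b) l ->
    cartesian T ACW (side (induced T S) b a) r ->
    cartesian T ACW S (Node a b l r).

Definition is_cartesian_tree (V : finType) (R : realDomainType) (T : rel V)
    (ACW : V -> V -> R) (t : ctree V) :=
  cartesian T ACW [set: V] t.

Fixpoint leaves (V : Type) (t : ctree V) : seq V :=
  match t with
  | Leaf v => [:: v]
  | Node _ _ l r => leaves l ++ leaves r
  end.

(* The subtree rooted at the least common ancestor of the leaves x and y. *)
Fixpoint lca (V : eqType) (t : ctree V) (x y : V) : ctree V :=
  match t with
  | Leaf _ => t
  | Node _ _ l r =>
      if (x \in leaves l) && (y \in leaves l) then lca l x y
      else if (x \in leaves r) && (y \in leaves r) then lca r x y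
      else t
  end.

Definition height (V : Type) (R : nmodType) (ACW : V -> V -> R)
    (t : ctree V) : R :=
  match t with
  | Leaf _ => 0
  | Node a b _ _ => ACW a b
  end.

Definition induced_dist (V : eqType) (R : nmodType) (ACW : V -> V -> R)
    (t : ctree V) (x y : V) : R :=
  height ACW (lca t x y).

(* Main.v *)
Require Import Defs.
From HB Require Import structures.
From mathcomp Require Import all_boot all_order all_algebra.
Import Order.TTheory GRing.Theory Num.Theory.
Local Open Scope ring_scope.

(** For distinct x and y, Delta x y is the largest ACW value of an edge of T
    separating x from y, that is, of an edge of the tree path from x to y.
    Whatever separates x from y separates z from x or from y, hence the strong
    triangle inequality.  The heaviest edge e of the path from x to y satisfies
    (x, y) \in P(e), whence w_l(x, y) <= CW(e) <= ACW(e) <= Delta(x, y).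
    Conversely, along the path joining a pair of P(e), an optimal ultrametric
    is at most alpha * w_h(e), so that CW(e) <= alpha * w_h(e); and
    w_h(e) <= gamma * w_h(x, y) if e is on the path from x to y. *)

Set Implicit Arguments.
Unset Strict Implicit.
Unset Printing Implicit Defensive.

(** * Edge deletion, sides of an edge, and connectivity inside vertex sets *)

Section Graphs.
Variable V : finType.
Implicit Types (e T : rel V) (S : {set V}) (a b c d x y z : V) (p : seq V).

(** Phrased by connectivity rather than by membership of the edge in a path: symmetry and
    [separates_trans] then come from those of [connect], and the orientation of the edge is
    irrelevant. *)
Definition separates e a b x y := ~~ connect (del_edge e a b) x y.

(** The invariant carried down the recursion of [cartesian]: every vertex set met there spans a
    subtree. *)
Definition connected_in e S :=
  forall x y, x \in S -> y \in S -> connect (induced e S) x y.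

Lemma del_edge_sym e a b : symmetric e -> symmetric (del_edge e a b).
Proof.
move=> e_sym x y; rewrite /del_edge /= e_sym !xpair_eqE; congr andb.
by rewrite andbC [(x == a) && _]andbC [(x == b) && _]andbC.
Qed.

Lemma del_edge_connect_sym e a b :
  symmetric e -> connect_sym (del_edge e a b).
Proof. by move=> e_sym; apply/sym_connect_sym/del_edge_sym. Qed.

Lemma del_edgeC e a b : del_edge e a b =2 del_edge e b a.
Proof. by move=> x y; rewrite /del_edge /= [(_ != (a, b)) && _]andbC. Qed.

Lemma connect_del_edgeC e a b :
  connect (del_edge e a b) =2 connect (del_edge e b a).
Proof. exact/eq_connect/del_edgeC. Qed.

Lemma in_sideC e a b z : (z \in side e b a) = connect (del_edge e a b) b z.
Proof. by rewrite inE connect_del_edgeC. Qed.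

Lemma induced_sym e S : symmetric e -> symmetric (induced e S).
Proof. by move=> e_sym x y; rewrite /induced /= e_sym andbCA. Qed.

Lemma sub_connect_rel e e' x y : subrel e e' -> connect e x y -> connect e' x y.
Proof. by move=> sub; apply: connect_sub => u v /sub /connect1. Qed.

Lemma del_edge_induced_sub e S a b :
  subrel (del_edge (induced e S) a b) (del_edge e a b).
Proof. by move=> x y /and3P[/and3P[_ _ ?] ? ?]; apply/and3P. Qed.

(** A path that misses the vertex [a] uses no edge at [a], so deleting {a, b} leaves it intact. *)
Lemma connect_avoid e a b x p :
  path e x p -> a \notin x :: p -> connect (del_edge e a b) x (last x p).
Proof.
move=> e_p a_p; apply/connectP; exists p => //.
apply: (@sub_in_path _ (predC1 a) e _ _ _ _ _ e_p) => [u v | ].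
  rewrite /del_edge !unfold_in /= !xpair_eqE => u_a v_a ->.
  by rewrite (negPf u_a) (negPf v_a) andbF.
by apply/allP => u u_p; apply: contraNneq a_p => <-.
Qed.

(** A simple path from [a] to [b] avoiding the edge would close up with it into a cycle. That cycle
    has at least three vertices: an empty path gives a loop, and a path of one step is the deleted
    edge itself. *)
Lemma tree_edge_separates T a b :
  is_spanning_tree T -> T a b -> separates T a b a b.
Proof.
case=> T_sym T_irr _ T_acyc Tab; apply/negP => /connectP[p0 del_p0 b_p0].
case: (shortenP del_p0) b_p0 => {p0 del_p0} p del_p p_uniq _ b_p.
have T_p : path T a p by apply: sub_path del_p => u v /= /and3P[].
have /T_acyc : ucycle T (a :: p).
  by rewrite /ucycle /= rcons_path T_p -b_p T_sym Tab.
case: p del_p b_p {p_uniq T_p} => [_ b_a|c [|//]] /=.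
  by move: Tab; rewrite b_a /= T_irr.
by move=> /andP[/and3P[_ ne_ab _] _] b_c _; rewrite b_c eqxx in ne_ab.
Qed.

(** The vertices reachable from [a] or from [b] after the deletion form a set closed under [e]: the
    deleted edge only links two of its members. *)
Lemma connect_del_edge_cover e a b z : symmetric e -> connect e a z ->
  connect (del_edge e a b) a z || connect (del_edge e a b) b z.
Proof.
move=> e_sym; pose C :=
  [pred u | connect (del_edge e a b) a u || connect (del_edge e a b) b u].
have C_closed : closed e C.
  apply: (intro_closed (sym_connect_sym e_sym)) => u v e_uv; rewrite !inE.
  have [uv_ab|ne_ab] := eqVneq (u, v) (a, b).
    by case: uv_ab => _ ->; rewrite connect0 orbT.
  have [uv_ba|ne_ba] := eqVneq (u, v) (b, a).
    by case: uv_ba => _ ->; rewrite connect0.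
  have del_uv : connect (del_edge e a b) u v.
    by apply: connect1; rewrite /del_edge /= e_uv ne_ab ne_ba.
  by case/orP => /connect_trans/(_ del_uv) ->; rewrite ?orbT.
by move/(closed_connect C_closed); rewrite !inE connect0 => <-.
Qed.

(** All vertices of a path starting in a component stay in that component, so the path lives in the
    induced graph. *)
Lemma component_connected e a :
  symmetric e -> connected_in e [set z | connect e a z].
Proof.
move=> e_sym x y; rewrite !inE => a_x a_y.
have x_y : connect e x y.
  by apply: connect_trans a_y; rewrite sym_connect_sym.
have /connectP[p e_p ->] := x_y; apply/connectP; exists p => //.
elim: p x a_x e_p {a_y x_y} => //= z p IHp x a_x /andP[e_xz e_p].
have a_z := connect_trans a_x (connect1 e_xz).
by rewrite /induced /= !inE a_x a_z e_xz IHp.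
Qed.

Lemma side_connected T S a b : symmetric T ->
  connected_in T (side (induced T S) a b).
Proof.
move=> T_sym x y x_S y_S.
have del_sym := del_edge_sym a b (induced_sym S T_sym).
apply: sub_connect_rel (component_connected del_sym x_S y_S) => u v.
by case/and3P=> u_S v_S /and3P[/and3P[_ _ Tuv] _ _]; apply/and3P.
Qed.

(** A path from [x] to [y] inside [S] survives the deletion of an edge not contained in [S]. Hence
    every edge separating [x] from [y] competes in the maximum taken at a node with vertex set
    [S]. *)
Lemma separates_in T S c d x y : connected_in T S -> x \in S -> y \in S ->
  T c d -> separates T c d x y -> induced T S c d.
Proof.
move=> S_conn x_S y_S Tcd; apply: contraR; rewrite /induced /= Tcd andbT => ncd_S.
apply: sub_connect_rel (S_conn x y x_S y_S) => u v /and3P[u_S v_S Tuv].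
by apply/and3P; split=> //; apply: contraNneq ncd_S => -[<- <-]; rewrite u_S v_S.
Qed.

Lemma separates_sym e a b x y :
  symmetric e -> separates e a b x y = separates e a b y x.
Proof. by move=> e_sym; rewrite /separates del_edge_connect_sym. Qed.

Lemma separates_trans e a b x y z :
  separates e a b x y -> separates e a b x z || separates e a b z y.
Proof.
apply: contraR; rewrite negb_or !negbK => /andP[x_z z_y].
exact: connect_trans z_y.
Qed.

(** A connection from [x] to [y] avoiding {a, b} would extend through both sides to one from [a] to
    [b]. The sides are taken within [S], but the separation holds in all of [T]. *)
Lemma sides_separate T S a b x y : is_spanning_tree T -> induced T S a b ->
  x \in side (induced T S) a b -> y \in side (induced T S) b a ->
  separates T a b x y.
Proof.
move=> T_tree /and3P[_ _ Tab]; rewrite [y \in _]in_sideC inE => a_x b_y.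
have T_sym : symmetric T by case: T_tree.
have a'_x := sub_connect_rel (@del_edge_induced_sub T S a b) a_x.
have b'_y := sub_connect_rel (@del_edge_induced_sub T S a b) b_y.
apply: contra (tree_edge_separates T_tree Tab) => x_y.
apply: connect_trans a'_x (connect_trans x_y _).
by rewrite del_edge_connect_sym.
Qed.

Lemma side_sub T S a b : symmetric T -> a \in S ->
  side (induced T S) a b \subset S.
Proof.
move=> T_sym a_S; apply/subsetP => z; rewrite inE.
suff S_closed : closed (del_edge (induced T S) a b) S.
  by move/(closed_connect S_closed) <-.
apply: intro_closed => [|u v /and3P[/and3P[]] //].
exact/del_edge_connect_sym/induced_sym.
Qed.

Lemma sides_cover T S a b : symmetric T -> connected_in T S ->
  induced T S a b ->
  side (induced T S) a b :|: side (induced T S) b a = S.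
Proof.
move=> T_sym S_conn /and3P[a_S b_S _]; apply/eqP.
rewrite eqEsubset subUset !side_sub //=; apply/subsetP => z z_S.
rewrite in_setU [z \in side _ b a]in_sideC inE.
apply: connect_del_edge_cover (S_conn _ _ _ _) => //.
exact: induced_sym.
Qed.

(** * Tree paths and the edges that separate their endpoints *)

Lemma tree_pathP T x y : is_spanning_tree T ->
  [/\ path T x (tree_path T x y), last x (tree_path T x y) = y &
      uniq (x :: tree_path T x y)].
Proof.
case=> _ _ T_conn _; rewrite /tree_path.
case: pickP => [p /and3P[? /eqP ? ?] // | no_p].
have /connectP[p0 T_p0 y_p0] := T_conn x y.
case: (shortenP T_p0) y_p0 => {p0 T_p0} p T_p p_uniq _ y_p.
have p_size : (size p <= #|V|)%N.
  by rewrite -(card_uniqP (subseq_uniq (subseq_cons p x) p_uniq)) max_card.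
by have /and3P[] := no_p (Bseq p_size); rewrite y_p.
Qed.

Lemma mem_zip_edge c d x p :
  (c, d) \in zip (x :: p) p -> (c \in x :: p) && (d \in p).
Proof.
elim: p x => //= z p IHp x; rewrite in_cons => /predU1P[[-> ->]|/IHp/andP[c_p d_p]].
  by rewrite !mem_head.
by rewrite [c \in _]in_cons [d \in _]in_cons c_p d_p !orbT.
Qed.

Lemma mem_zip_path e c d x p :
  path e x p -> (c, d) \in zip (x :: p) p -> e c d.
Proof.
elim: p x => //= z p IHp x /andP[e_xz e_p].
by rewrite in_cons => /predU1P[[-> ->] //|/(IHp z)]; apply.
Qed.

(** In a simple path the starting vertex does not recur. So if (c, d) is the first edge, the rest
    avoids [c]; if it comes later, the first edge differs from it and survives the deletion. *)
Lemma mem_zip_path_sides e c d x p : path e x p -> uniq (x :: p) ->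
  (c, d) \in zip (x :: p) p ->
  connect (del_edge e c d) x c && connect (del_edge e c d) d (last x p).
Proof.
elim: p x => // z p IHp x /andP[e_xz e_p] /andP[x_zp zp_uniq].
rewrite in_cons => /predU1P[[-> ->]|cd_p].
  by rewrite connect0 (connect_avoid _ e_p).
have /andP[z_c ->] := IHp _ e_p zp_uniq cd_p; rewrite andbT.
apply: connect_trans (connect1 _) z_c.
have /andP[c_zp d_p] := mem_zip_edge cd_p.
rewrite /del_edge /= e_xz !xpair_eqE.
rewrite ![x == _]eq_sym (negPf (memPn x_zp _ c_zp)).
by rewrite (negPf (memPn x_zp _ _)) // in_cons d_p orbT.
Qed.

Lemma path_edge_sides T c d x y : is_spanning_tree T ->
  (c, d) \in path_edges T x y -> (x \in side T c d) && (y \in side T d c).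
Proof.
move=> T_tree; have [T_p last_p p_uniq] := tree_pathP x y T_tree.
move/(mem_zip_path_sides T_p p_uniq); rewrite last_p [y \in _]in_sideC inE.
by rewrite del_edge_connect_sym //; case: T_tree.
Qed.

Lemma path_edge_tree T c d x y : is_spanning_tree T ->
  (c, d) \in path_edges T x y -> T c d.
Proof.
move=> T_tree; have [T_p _ _] := tree_pathP x y T_tree.
exact: mem_zip_path.
Qed.

Lemma path_edge_separates T c d x y : is_spanning_tree T ->
  (c, d) \in path_edges T x y -> separates T c d x y.
Proof.
move=> T_tree cd_xy; have Tcd := path_edge_tree T_tree cd_xy.
have T_sym : symmetric T by case: T_tree.
have := path_edge_sides T_tree cd_xy.
rewrite [y \in _]in_sideC inE => /andP[c_x d_y].
apply: contra (tree_edge_separates T_tree Tcd) => x_y.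
apply: connect_trans c_x (connect_trans x_y _).
by rewrite del_edge_connect_sym.
Qed.

Lemma connect_del_edge_zip e a b x p : path e x p ->
  (a, b) \notin zip (x :: p) p -> (b, a) \notin zip (x :: p) p ->
  connect (del_edge e a b) x (last x p).
Proof.
elim: p x => // z p IHp x /andP[e_xz e_p].
rewrite !in_cons !negb_or => /andP[ab_xz ab_p] /andP[ba_xz ba_p].
apply: connect_trans (connect1 _) (IHp _ e_p ab_p ba_p).
by rewrite /del_edge /= e_xz eq_sym ab_xz eq_sym ba_xz.
Qed.

Lemma separates_path_edge T a b x y : is_spanning_tree T ->
  separates T a b x y ->
  ((a, b) \in path_edges T x y) || ((b, a) \in path_edges T x y).
Proof.
move=> T_tree; have [T_p last_p _] := tree_pathP x y T_tree.
apply: contraR; rewrite negb_or => /andP[nab nba].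
by have := connect_del_edge_zip T_p nab nba; rewrite last_p.
Qed.

End Graphs.

(** * Leaves of a cartesian tree and its induced distance *)

Section CartesianTrees.
Variables (V : finType) (R : realDomainType) (T : rel V) (ACW : V -> V -> R).
Hypothesis T_tree : is_spanning_tree T.
Implicit Types (S : {set V}) (t : ctree V).

Let T_sym : symmetric T. Proof. by case: T_tree. Qed.

Lemma cartesian_leaves S t :
  connected_in T S -> cartesian T ACW S t -> leaves t =i S.
Proof.
move=> + t_cart; elim: t_cart => {S t} [v|S a b l r Sab _ _ IHl _ IHr] S_conn z.
  by rewrite !inE.
rewrite -(sides_cover T_sym S_conn Sab) in_setU /= mem_cat.
by rewrite (IHl (side_connected T_sym)) (IHr (side_connected T_sym)).
Qed.

Lemma induced_dist_diag S t x : connected_in T S -> cartesian T ACW S t ->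
  x \in S -> induced_dist ACW t x x = 0.
Proof.
move=> + t_cart.
elim: t_cart => {S t} // S a b l r Sab _ l_cart IHl r_cart IHr S_conn.
have side_conn c d := @side_connected _ T S c d T_sym.
rewrite -(sides_cover T_sym S_conn Sab) in_setU /induced_dist /= !andbb.
rewrite !(cartesian_leaves (side_conn _ _) l_cart).
rewrite !(cartesian_leaves (side_conn _ _) r_cart).
case: ifP => [x_l _|_ /= x_r]; first exact: IHl.
by rewrite x_r; apply: IHr.
Qed.

Lemma induced_dist_sym t x y : induced_dist ACW t x y = induced_dist ACW t y x.
Proof.
elim: t => //= a b l IHl r IHr; rewrite /induced_dist /=.
rewrite [(x \in leaves l) && _]andbC [(x \in leaves r) && _]andbC.
by case: ifP => // _; case: ifP.
Qed.

(** Induction on the cartesian tree. If the root edge splits [x] from [y], it is their least common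
    ancestor, and its maximality over [S] covers all separating edges by [separates_in]. Otherwise
    both vertices lie in one subtree. *)
Lemma induced_distE S t x y : connected_in T S -> cartesian T ACW S t ->
  x \in S -> y \in S -> x != y ->
  exists a b, [/\ T a b, separates T a b x y, induced_dist ACW t x y = ACW a b &
    forall c d, T c d -> separates T c d x y -> ACW c d <= ACW a b].
Proof.
move=> + t_cart; elim: t_cart => {S t}.
  by move=> v _; rewrite !inE => /eqP-> /eqP->; rewrite eqxx.
move=> S a b l r Sab ab_max l_cart IHl r_cart IHr S_conn x_S y_S ne_xy.
have side_conn c d := @side_connected _ T S c d T_sym.
have Tab : T a b by case/and3P: Sab.
have l_leaves := cartesian_leaves (side_conn _ _) l_cart.
have r_leaves := cartesian_leaves (side_conn _ _) r_cart.
(* A leaf common to both subtrees would be separated from itself. *)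
have disj z : z \in leaves l -> z \in leaves r -> False.
  rewrite l_leaves r_leaves => z_l z_r.
  by have := sides_separate T_tree Sab z_l z_r; rewrite /separates connect0.
have at_root : separates T a b x y ->
    exists c d, [/\ T c d, separates T c d x y, ACW a b = ACW c d &
      forall u v, T u v -> separates T u v x y -> ACW u v <= ACW c d].
  move=> ab_xy; exists a, b; split=> // u v Tuv uv_xy.
  exact/ab_max/(separates_in S_conn x_S y_S).
have S_lr z : z \in S -> (z \in leaves l) || (z \in leaves r).
  by rewrite l_leaves r_leaves -in_setU sides_cover.
rewrite /induced_dist /=.
have /orP[x_l|x_r] := S_lr x x_S; have /orP[y_l|y_r] := S_lr y y_S.
- by rewrite x_l y_l; apply: IHl; rewrite // -l_leaves.
- rewrite x_l y_r andbT (introF idP (disj y ^~ y_r)).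
  rewrite (introF idP (disj x x_l)) /=.
  apply: at_root; apply: (sides_separate T_tree Sab).
    by rewrite -l_leaves.
  by rewrite -r_leaves.
- rewrite x_r y_l /= andbT (introF idP (disj x ^~ x_r)).
  rewrite (introF idP (disj y y_l)) /=.
  apply: at_root; rewrite separates_sym //.
  by apply: (sides_separate T_tree Sab); rewrite -?l_leaves -?r_leaves.
- rewrite x_r y_r (introF idP (disj x ^~ x_r)).
  by apply: IHr; rewrite // -r_leaves.
Qed.

End CartesianTrees.

(** * Bounds on cut weights and path edges, and the approximation guarantee *)

Lemma tree_connected_setT (V : finType) (T : rel V) :
  is_spanning_tree T -> connected_in T [set: V].
Proof.
case=> _ _ T_conn _ x y _ _; apply: sub_connect_rel (T_conn x y) => u v Tuv.
by rewrite /induced /= !in_setT.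
Qed.

Lemma heaviest_path_edge (V : finType) (R : realDomainType) (T : rel V)
    (w : V -> V -> R) (x y : V) : is_spanning_tree T -> x != y ->
  exists c d, (c, d) \in path_edges T x y /\
    all (fun f => w f.1 f.2 <= w c d) (path_edges T x y).
Proof.
move=> T_tree ne_xy; have [_ last_p _] := tree_pathP x y T_tree.
(* Distinct endpoints make the path nonempty; its first edge is the initial candidate for the
   maximum. *)
have [e e_xy] : exists e, e \in path_edges T x y.
  rewrite /path_edges; case: (tree_path T x y) last_p => [/= eq_xy | z p _].
    by rewrite eq_xy eqxx in ne_xy.
  by exists (x, z); rewrite mem_head.
have [[c d] cd_xy cd_max] :=
  @arg_maxP _ _ _ e [in path_edges T x y] (fun f => w f.1 f.2) e_xy.
by exists c, d; split=> //; apply/allP.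
Qed.

(** Iterating the strong triangle inequality takes a maximum instead of a sum, so the length of the
    path does not enter. The bound [0 <= B] serves the empty path. *)
Lemma strong_triangle_path (V : eqType) (R : realDomainType) (D : V -> V -> R)
    (B : R) (x : V) (p : seq V) :
  strong_triangle D -> (forall z, D z z = 0) -> 0 <= B ->
  (forall c d, (c, d) \in zip (x :: p) p -> D c d <= B) -> D x (last x p) <= B.
Proof.
move=> D_strong D_diag B_ge0; elim: p x => [|z p IHp] x p_le /=.
  by rewrite D_diag.
apply: le_trans (D_strong x _ z) _; rewrite ge_max p_le ?mem_head //=.
by apply: IHp => c d cd_p; apply: p_le; rewrite in_cons cd_p orbT.
Qed.

(* Below 0 there is no minimal factor: then w_h <= 0, so that decreasing the
   factor only weakens the upper bound. *)
Lemma alpha_opt_ge0 (V : Type) (R : realDomainType) (wl wh : V -> V -> R)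
    (alpha : R) : is_alpha_opt wl wh alpha -> 0 <= alpha.
Proof.
case=> -[D [D_ultra D_bounds]] alpha_min; rewrite leNgt; apply/negP => alpha_lt0.
suff /alpha_min : feasible wl wh (alpha - 1) by rewrite lerDl oppr_ge0 leNgt ltr01.
exists D; split=> // x y; have /andP[-> D_le] := D_bounds x y => /=.
have [[[D_ge0 _ _ _] _] _] := D_ultra.
have wh_le0 : wh x y <= 0.
  by rewrite -(nmulr_rge0 _ alpha_lt0); apply: le_trans D_le.
by rewrite mulrBl mul1r; apply: le_trans D_le _; rewrite lerDl oppr_ge0.
Qed.

Lemma cut_weight_le (V : finType) (R : realDomainType) (T : rel V)
    (wl wh D : V -> V -> R) (alpha : R) (a b : V) :
  is_spanning_tree T -> is_pseudo_ultrametric D -> 0 <= alpha ->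
  (forall x y, wl x y <= D x y <= alpha * wh x y) ->
  cut_weight T wl wh a b <= alpha * wh a b.
Proof.
move=> T_tree [[D_ge0 D_diag _ _] D_strong] alpha_ge0 D_bounds.
have D_wh x y : D x y <= alpha * wh x y by case/andP: (D_bounds x y).
have wl_D x y : wl x y <= D x y by case/andP: (D_bounds x y).
(* The first goal is the default value [wl a b] of the maximum, bounded through [D a b]. *)
apply: bigmax_le => [|[u v]]; first exact: le_trans (D_wh _ _).
rewrite inE => /and4P[_ _ _ /allP ab_max]; apply: le_trans (wl_D _ _) _.
have [_ last_p _] := tree_pathP u v T_tree; rewrite /= -{1}last_p.
apply: strong_triangle_path => // [|c d /ab_max cd_ab].
  exact: le_trans (D_wh _ _).
exact: le_trans (D_wh _ _) (ler_wpM2l alpha_ge0 cd_ab).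
Qed.

(** The path edges lie on the cycle closed by (x, y), so [cycle_max] dominates each of them. *)
Lemma approx_kruskal_path_edge (V : finType) (R : realFieldType) (gamma : R)
    (w : V -> V -> R) (T : rel V) (a b x y : V) :
  0 < gamma -> is_approx_kruskal_tree gamma w T -> x != y -> ~~ T x y ->
  (a, b) \in path_edges T x y -> w a b <= gamma * w x y.
Proof.
move=> gamma_gt0 [_ T_KT] ne_xy nT_xy ab_xy.
rewrite -ler_pdivrMl //; apply: le_trans (T_KT x y ne_xy nT_xy).
rewrite ler_wpM2l ?invr_ge0 ?(ltW gamma_gt0) //.
exact: (le_bigmax_seq _ (a, b) xpredT (fun f => w f.1 f.2)).
Qed.

(** The distance of distinct vertices is the [ACW] value of a tree edge, so the sign of these values
    governs the axioms: a zero value puts distinct vertices at distance 0, and a negative one breaks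
    nonnegativity. *)
Theorem theorem3p1 (R : realFieldType) (V : finType) (wl wh : V -> V -> R)
    (wl_sym : forall x y : V, wl x y = wl y x)
    (wh_sym : forall x y : V, wh x y = wh y x)
    (alpha_opt : R) (alpha_optP : is_alpha_opt wl wh alpha_opt)
    (gamma delta : R) (gamma_ge1 : 1 <= gamma) (delta_ge1 : 1 <= delta)
    (T : rel V) (T_KT : is_approx_kruskal_tree gamma wh T)
    (ACW : V -> V -> R) (ACW_est : is_cut_weight_estimate delta T wl wh ACW)
    (TC : ctree V) (TC_cart : is_cartesian_tree T ACW TC) :
  let Delta := induced_dist ACW TC in
  [/\ (forall a b : V, T a b -> 0 < ACW a b) -> is_ultrametric Delta,
      (forall a b : V, T a b -> 0 <= ACW a b) -> is_pseudo_ultrametric Delta &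
      forall x y : V,
        wl x y <= Delta x y <= gamma * delta * alpha_opt * wh x y].
Proof.
move=> Delta; have [T_tree _] := T_KT; have [_ ACW_bounds] := ACW_est.
have T_conn := tree_connected_setT T_tree.
have Delta_diag x : Delta x x = 0 by apply: induced_dist_diag TC_cart _.
have Delta_sym x y : Delta x y = Delta y x by apply: induced_dist_sym.
have DeltaE x y : x != y -> exists a b,
    [/\ T a b, separates T a b x y, Delta x y = ACW a b &
      forall c d, T c d -> separates T c d x y -> ACW c d <= Delta x y].
  move=> ne_xy.
  have [a [b [Tab ab_xy Delta_ab ab_max]]] :=
    induced_distE T_tree T_conn TC_cart (in_setT x) (in_setT y) ne_xy.
  by exists a, b; rewrite /Delta Delta_ab.
have Delta_ge x y c d : T c d -> separates T c d x y -> ACW c d <= Delta x y.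
  move=> Tcd cd_xy; have ne_xy : x != y.
    by apply: contraNneq cd_xy => ->; apply: connect0.
  by have [a [b [_ _ _]]] := DeltaE x y ne_xy; apply.
have pseudo : (forall a b, T a b -> 0 <= ACW a b) -> is_pseudo_ultrametric Delta.
  move=> ACW_ge0.
  have Delta_ge0 x y : 0 <= Delta x y.
    have [->|/DeltaE[a [b [Tab _ -> _]]]] := eqVneq x y; last exact: ACW_ge0.
    by rewrite Delta_diag.
  have Delta_strong : strong_triangle Delta.
    move=> x y z; have [->|/DeltaE[a [b [Tab ab_xy -> _]]]] := eqVneq x y.
      by rewrite Delta_diag le_max Delta_ge0.
    rewrite le_max.
    case/orP: (separates_trans z ab_xy) => /(Delta_ge _ _ _ _ Tab) -> //.
    by rewrite orbT.
  split=> //; split=> // x y z; apply: le_trans (Delta_strong x y z) _.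
  by rewrite ge_max lerDl lerDr !Delta_ge0.
split=> // [ACW_gt0|x y].
  have [|pseudo_Delta strong_Delta] := pseudo; first by move=> a b /ACW_gt0/ltW.
  split=> //; split=> // x y Delta0; apply/eqP; apply: contraTT isT => ne_xy.
  have [a [b [Tab _ Delta_ab _]]] := DeltaE x y ne_xy.
  by have := ACW_gt0 a b Tab; rewrite -Delta_ab Delta0 ltxx.
have alpha_ge0 := alpha_opt_ge0 alpha_optP.
have [[D [[[D_pseudo _] D_strong] D_bounds]] _] := alpha_optP.
have [D_ge0 D_diag _ _] := D_pseudo.
have alpha_wh_ge0 u v : 0 <= alpha_opt * wh u v.
  by have /andP[_ /(le_trans (D_ge0 _ _))] := D_bounds u v.
have gamma_gt0 : 0 < gamma := lt_le_trans ltr01 gamma_ge1.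
have delta_ge0 : 0 <= delta := le_trans ler01 delta_ge1.
(* Regroups the bound as [delta * (gamma * (alpha_opt * wh x y))], so that the factors are peeled
   off in the order estimate, Kruskal tree, optimum. *)
rewrite [gamma * _]mulrC -!mulrA.
have [->|ne_xy] := eqVneq x y.
  rewrite Delta_diag; have /andP[wl_le _] := D_bounds y y.
  rewrite D_diag in wl_le; rewrite wl_le mulr_ge0 //.
  by rewrite mulr_ge0 // ltW.
apply/andP; split.
  have [c [d [cd_xy cd_max]]] := heaviest_path_edge wh T_tree ne_xy.
  have Tcd := path_edge_tree T_tree cd_xy.
  apply: le_trans (Delta_ge x y c d Tcd (path_edge_separates T_tree cd_xy)).
  have /andP[+ _] := ACW_bounds c d Tcd; apply: le_trans.
  apply: (@le_bigmax_cond _ _ _ _ (x, y) _ (fun u => wl u.1 u.2)).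
  have /andP[x_c y_d] := path_edge_sides T_tree cd_xy.
  by rewrite inE; apply/and4P.
have [a [b [Tab ab_xy -> _]]] := DeltaE x y ne_xy.
have /andP[_ /le_trans] := ACW_bounds a b Tab; apply.
rewrite ler_wpM2l //.
have D_ultra : is_pseudo_ultrametric D by [].
apply: le_trans (cut_weight_le _ _ T_tree D_ultra alpha_ge0 D_bounds) _.
(* The Kruskal condition speaks of edges outside [T] only. If (x, y) is a tree edge, it is its own
   tree path, and [1 <= gamma] suffices. *)
have [Txy|nTxy] := boolP (T x y); last first.
  rewrite mulrCA ler_wpM2l //.
  have /orP[ab_p|ba_p] := separates_path_edge T_tree ab_xy.
    exact: approx_kruskal_path_edge T_KT _ _ ab_p.
  by rewrite wh_sym; apply: approx_kruskal_path_edge T_KT _ _ ba_p.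
(* Were the weights different, {x, y} would not be {a, b}, would survive its deletion, and would
   still join [x] to [y]. *)
have -> : wh a b = wh x y.
  have : ~~ connect (del_edge T a b) x y := ab_xy.
  apply: contraNeq => ne_wh; apply: connect1; apply/and3P.
  by split=> //; apply: contraNneq ne_wh => -[-> ->]; rewrite // wh_sym.
by rewrite ler_peMl.
Qed.
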